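(* Let $G$ be a nontrivial connected graph and let $n\geq 3$ be an integer. If $n^2\lambda'(G)>n\,\xi(G)+2(n-1)$, then the direct product $G\times T_n$ is super restricted edge-connected (super-$\lambda'$).
   Context: $G$ is a finite simple graph; it is nontrivial if it has at least two vertices. The total graph $T_n$ is the graph obtained from the complete graph $K_n$ on $n$ vertices by adding a loop at each vertex, so any two (possibly equal) vertices of $T_n$ are adjacent. For an edge $uv\in E(G)$ its edge-degree is $d_G(u)+d_G(v)-2$, and the minimum edge-degree is $\xi(G)=\min\{d_G(u)+d_G(v)-2: uv\in E(G)\}$. For a graph $H$, an edge subset $F\subseteq E(H)$ is an edge-cut if $H-F$ (delete the edges in $F$, keep all vertices) is disconnected. A restricted edge-cut of $H$ is an edge-cut $F$ such that every component of $H-F$ has at least two vertices (equivalently, $H-F$ is disconnected and has no isolated vertices). The restricted edge-connectivity $\lambda'(H)$ is the cardinality of a minimum (i.e. smallest-cardinality) restricted edge-cut of $H$ if $H$ has a restricted edge-cut, and $\lambda'(H)=+\infty$ otherwise (so an inequality $n^2\lambda'(G)>c$ with finite $c$ holds when $\lambda'(G)=+\infty$). $H$ is super restricted edge-connected (super-$\lambda'$) if every minimum restricted edge-cut $F$ of $H$ isolates an edge from $H$, i.e. some component of $H-F$ consists of exactly two vertices joined by an edge. The direct product $G_1\times G_2$ has vertex set $V(G_1)\times V(G_2)$, with $(u_1,v_1)$ adjacent to $(u_2,v_2)$ if and only if $u_1u_2\in E(G_1)$ and $v_1v_2\in E(G_2)$ (where $vv\in E(G_2)$ means there is a loop at $v$).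 *)

(* Defs.v *)
From mathcomp Require Import all_boot all_order all_algebra.
From mathcomp Require Import constructive_ereal.

Set Implicit Arguments.
Unset Strict Implicit.
Unset Printing Implicit Defensive.

(* A graph is a symmetric relation on a finite type of vertices; it is simple
   when the relation is also irreflexive, and a loop at x means [e x x]. *)

Definition complete_graph (n : nat) : rel 'I_n := [rel i j | i != j].

Definition total_graph (n : nat) : rel 'I_n :=
  [rel i j | complete_graph i j || (i == j)].

Definition direct_product (T1 T2 : finType) (e1 : rel T1) (e2 : rel T2) :
    rel (T1 * T2) :=
  [rel p q | e1 p.1 q.1 && e2 p.2 q.2].

Section Graph.
Variables (T : finType) (e : rel T).

(* The edge between x and y is the unordered pair [set x; y]. *)
Definition edge_set : {set {set T}} :=
  [set [set p.1; p.2] | p : T * T & e p.1 p.2].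

Definition delete_edges (F : {set {set T}}) : rel T :=
  [rel x y | e x y && ([set x; y] \notin F)].

Definition connected_graph : Prop := forall x y : T, connect e x y.

Definition components : {set {set T}} :=
  equivalence_partition (connect e) [set: T].

(* Number of neighbours: the degree in the absence of loops. *)
Definition degree (x : T) : nat := #|[set y | e x y]|.

End Graph.

Section RestrictedEdgeConnectivity.
Variables (T : finType) (e : rel T).

Definition edge_cut (F : {set {set T}}) : bool :=
  (F \subset edge_set e)
    && [exists x, exists y, ~~ connect (delete_edges e F) x y].

Definition restricted_edge_cut (F : {set {set T}}) : bool :=
  edge_cut F && [forall C in components (delete_edges e F), 2 <= #|C|].

Definition min_restricted_edge_cut (F : {set {set T}}) : Prop :=
  restricted_edge_cut F
    /\ forall F', restricted_edge_cut F' -> #|F| <= #|F'|.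

Definition isolates_edge (F : {set {set T}}) : Prop :=
  exists x y : T, [/\ x != y, delete_edges e F x y
    & [set x; y] \in components (delete_edges e F)].

Definition super_restricted_edge_connected : Prop :=
  forall F, min_restricted_edge_cut F -> isolates_edge F.

Local Open Scope ring_scope.
Local Open Scope ereal_scope.

(* Both minima take values in [\bar int], the minimum of the empty family being
   +oo: this is the intended value for a graph without restricted edge-cuts. *)

Definition min_edge_degree : \bar int :=
  \big[Order.min/+oo]_(p : T * T | e p.1 p.2)
     ((degree e p.1)%:Z + (degree e p.2)%:Z - 2)%R%:E.

Definition restricted_edge_connectivity : \bar int :=
  \big[Order.min/+oo]_(F : {set {set T}} | restricted_edge_cut F)
     (#|F|%:Z)%R%:E.

End RestrictedEdgeConnectivity.

(* Main.v *)
(** G x T_n replaces each vertex of G by n independent copies. Let X be one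
    component left by a minimum restricted edge-cut that isolates no edge; then
    each side of X has no isolated vertex and no component with two vertices.
    Call a vertex u of G split when X contains some but not all copies of u.
    Every edge of G at a split vertex carries at least n edges of the cut, so
    two adjacent split vertices u and v, or a split vertex next to a vertex v
    all of whose edges carry n edges of the cut, force at least
    n (d(u) + d(v)) - 1 edges: more than the cut n (d(u) + d(v)) - 2 around an
    edge of minimum edge-degree. Otherwise each slice
    {w | (w, k) in X} induces a restricted edge-cut of G, and the slices have
    |cut(X)| / n edges altogether, whence |cut(X)| >= n^2 lambda'(G), which is
    again too large. *)

Require Import Defs.
From mathcomp Require Import all_boot all_order all_algebra.
From mathcomp Require Import constructive_ereal.
From mathcomp Require Import zify.

Set Implicit Arguments.
Unset Strict Implicit.
Unset Printing Implicit Defensive.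

(** * Edge boundaries of vertex sets *)

Section Boundary.
Variables (T : finType) (e : rel T).
Hypothesis e_sym : symmetric e.

Definition boundary (S : {set T}) : {set {set T}} :=
  [set [set p.1; p.2] | p : T * T & [&& e p.1 p.2, p.1 \in S & p.2 \notin S]].

Lemma delete_edgesE F x y :
  delete_edges e F x y = e x y && ([set x; y] \notin F).
Proof. by []. Qed.

Lemma boundaryP (S : {set T}) x y :
  ([set x; y] \in boundary S) = e x y && ((x \in S) != (y \in S)).
Proof.
apply/imsetP/andP => [[[a b]]|[exy]].
  rewrite inE /= => /and3P[eab aS bS] /setP E.
  have := E x; have := E y; have := E a; have := E b.
  rewrite !inE !eqxx !orbT /=.
  by move=> /orP[]/eqP Ea /orP[]/eqP Eb _ _; subst a b;
    rewrite ?aS in bS *; rewrite // 1?e_sym eab (negbTE bS).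
case xS : (x \in S); case yS : (y \in S) => // _.
  by exists (x, y); rewrite // inE /= exy xS yS.
by exists (y, x); [rewrite inE /= e_sym exy xS yS | rewrite setUC].
Qed.

Lemma card_boundary (S : {set T}) :
  #|boundary S| = \sum_u \sum_(v | e u v) (u \in S) * (v \notin S).
Proof.
rewrite card_in_imset => [|[a b] [c d]]; last first.
  rewrite !inE /= => /and3P[_ aS bS] /and3P[_ cS dS] /setP E.
  have := E a; have := E b; rewrite !inE !eqxx orbT /=.
  case/esym/orP=> /eqP Eb; first by rewrite Eb cS in bS.
  case/esym/orP=> /eqP Ea; last by rewrite -Ea aS in dS.
  by rewrite Ea Eb.
rewrite -sum1_card pair_big_dep /= big_mkcond [RHS]big_mkcond /=.
by apply: eq_bigr => -[a b] _; rewrite !inE /=; case: (e a b); case: (a \in S); case: (b \in S).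
Qed.

(** Deleting the boundary makes [S] closed under adjacency, which separates [x] from [y]; the edge
    from [z] to [t] survives, so no component is a single vertex. *)
Lemma boundary_restricted (S : {set T}) x y :
    x \in S -> y \notin S ->
    (forall z, exists t, [/\ e z t, t != z & (t \in S) = (z \in S)]) ->
  restricted_edge_cut e (boundary S).
Proof.
move=> xS yS nbr; have closedS : closed (delete_edges e (boundary S)) S.
  by move=> a b; rewrite delete_edgesE boundaryP => /andP[->]; rewrite negbK => /eqP.
apply/andP; split; first (apply/andP; split).
- apply/subsetP => _ /imsetP[p pP ->]; apply/imsetP; exists p => //.
  by move: pP; rewrite !inE => /andP[].
- apply/existsP; exists x; apply/existsP; exists y; apply: contra yS.
  by move/(closed_connect closedS) => <-.
apply/forall_inP => _ /imsetP[z _ ->]; have [t [ezt tz tS]] := nbr z.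
have <- : #|[set z; t]| = 2 by rewrite cards2 eq_sym tz.
apply/subset_leq_card/subsetP => w; rewrite !inE => /orP[]/eqP->; first exact: connect0.
by apply: connect1; rewrite delete_edgesE ezt boundaryP tS eqxx andbF.
Qed.

End Boundary.

(** Rows and columns [u] and [v] of the matrix [F] overlap only in the entries [F u v] and [F v u],
    apart from diagonal entries that vanish. *)
Lemma sum_incident_le (T : finType) (F : T -> T -> nat) (u v : T) :
    u != v -> F u u = 0 -> F v v = 0 ->
  \sum_t (F u t + F t u) + \sum_t (F v t + F t v)
    <= \sum_a \sum_b F a b + (F u v + F v u).
Proof.
move=> uv Fuu Fvv.
have split2 (f : T -> nat) :
    \sum_t f t = f u + (f v + \sum_(t | (t != u) && (t != v)) f t).
  by rewrite (bigD1 u) //= (bigD1 v) // eq_sym.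
have -> : \sum_t (F u t + F t u) = \sum_t F u t + \sum_t F t u by rewrite big_split.
have -> : \sum_t (F v t + F t v) = \sum_t F v t + \sum_t F t v by rewrite big_split.
rewrite (split2 (fun a => \sum_b F a b)) (split2 (F^~ u)) (split2 (F^~ v)).
have : \sum_(t | (t != u) && (t != v)) F t u + \sum_(t | (t != u) && (t != v)) F t v
       <= \sum_(t | (t != u) && (t != v)) \sum_b F t b.
  rewrite -big_split /=; apply: leq_sum => t _.
  by rewrite (split2 (F t)) addnA leq_addr.
by rewrite Fuu Fvv; lia.
Qed.

(** * Boundaries in the product, counted through the copies of each vertex of G *)

Section Product.
Variables (T : finType) (e : rel T) (n : nat).
Hypotheses (e_sym : symmetric e) (e_irr : irreflexive e).

Notation eH := (direct_product e (@total_graph n)).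

Lemma product_totalE p q : eH p q = e p.1 q.1.
Proof. by rewrite /direct_product /total_graph /complete_graph /= orNb andbT. Qed.

Lemma product_total_sym : symmetric eH.
Proof. by move=> p q; rewrite !product_totalE e_sym. Qed.

Section Cut.
Variable X : {set T * 'I_n}.
Hypothesis n_ge3 : 3 <= n.

(** The side is a boolean, so that one argument serves both [X] and its complement. *)
Definition copies (s : bool) (u : T) : nat :=
  #|[set i : 'I_n | ((u, i) \in X) == s]|.

(** For adjacent [u] and [v], this counts the boundary edges of [X] between copies of [u] and copies
    of [v]. *)
Definition crossing (u v : T) : nat :=
  copies true u * copies false v + copies true v * copies false u.

Lemma sum_copies s u : \sum_(i < n) (((u, i) \in X) == s) = copies s u.
Proof.
rewrite /copies -sum1_card [RHS]big_mkcond; apply: eq_bigr => i _.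
by rewrite inE; case: eqP.
Qed.

Lemma copiesD s u : copies s u + copies (~~ s) u = n.
Proof.
rewrite -[RHS](card_ord n) -(cardsC [set i : 'I_n | ((u, i) \in X) == s]).
congr (_ + _); apply: eq_card => i; rewrite !inE.
by case: (_ \in X); case: s.
Qed.

Lemma copies_gt0P s u :
  reflect (exists i, ((u, i) \in X) = s) (0 < copies s u).
Proof.
apply: (iffP card_gt0P) => -[i us]; exists i.
  by apply/eqP; rewrite inE in us.
by rewrite inE us.
Qed.

Lemma copies_full s u i : copies (~~ s) u = 0 -> ((u, i) \in X) = s.
Proof.
move=> u0; apply/eqP/negPn/negP => us.
suff : 0 < copies (~~ s) u by rewrite u0.
by apply/copies_gt0P; exists i; move: us; case: (_ \in X); case: (s).
Qed.

Lemma copies_eq1 s u i j :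
  copies s u = 1 -> ((u, i) \in X) = s -> ((u, j) \in X) = s -> i = j.
Proof.
move=> /eqP/cards1P[k /setP uk] /eqP ui /eqP uj.
by have := uk i; have := uk j; rewrite !inE ui uj => /esym/eqP-> /esym/eqP->.
Qed.

Lemma crossingE s u v :
  crossing u v = copies s u * copies (~~ s) v + copies s v * copies (~~ s) u.
Proof. by rewrite /crossing; case: s => //=; lia. Qed.

Lemma crossingC u v : crossing u v = crossing v u.
Proof. exact: addnC. Qed.

Lemma crossing_full s u v :
  copies (~~ s) u = 0 -> crossing u v = n * copies (~~ s) v.
Proof. by move=> u0; rewrite (crossingE s) u0 -(copiesD s u) u0; lia. Qed.

(** Each of the n copies of [v] is opposite to at least one copy of [u]. *)
Lemma crossing_split s u v :
  0 < copies s u -> 0 < copies (~~ s) u -> n <= crossing u v.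
Proof.
by move=> us us'; rewrite (crossingE s) -(copiesD s v); nia.
Qed.

Lemma card_boundary_product :
  #|boundary eH X| = \sum_u \sum_(v | e u v) copies true u * copies false v.
Proof.
rewrite card_boundary.
have -> (f : T * 'I_n -> nat) : \sum_p f p = \sum_u \sum_i f (u, i).
  by rewrite pair_big; apply: eq_bigr => -[].
apply: eq_bigr => u _.
transitivity (\sum_(i < n) ((u, i) \in X) * \sum_(v | e u v) copies false v).
  apply: eq_bigr => i _; rewrite -big_distrr /=; congr (_ * _).
  transitivity (\sum_(v | e u v) \sum_(j < n) ((v, j) \notin X)).
    rewrite pair_big_dep /=; apply: eq_big => -[v j] //.
    by rewrite product_totalE andbT.
  apply: eq_bigr => v _; rewrite -sum_copies.
  by apply: eq_bigr => j _; case: (_ \in X).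
rewrite -big_distrl -big_distrr /=; congr (_ * _).
rewrite -sum_copies.
by apply: eq_bigr => j _; case: (_ \in X).
Qed.

Lemma incident_crossing_le u v : e u v ->
  \sum_(t | e u t) crossing u t + \sum_(t | e v t) crossing v t
    <= #|boundary eH X| + crossing u v.
Proof.
move=> euv; rewrite card_boundary_product.
pose F a b := if e a b then copies true a * copies false b else 0.
have uv : u != v by apply: contraTneq euv => ->; rewrite e_irr.
have star x : \sum_(t | e x t) crossing x t = \sum_t (F x t + F t x).
  rewrite big_mkcond; apply: eq_bigr => t _.
  by rewrite /F [e t x]e_sym; case: ifP.
rewrite !star; have := sum_incident_le (F := F) uv.
rewrite /F !e_irr euv e_sym euv => /(_ erefl erefl) /leq_trans; apply.
by rewrite leq_add2r; apply: leq_sum => a _; rewrite -big_mkcond.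
Qed.

Definition heavy u := forall t, e u t -> n <= crossing u t.

(** The edge to [t] keeps its exact count, every other edge at [u] counts at least n, and the n on
    the right makes up for the term of [t]. *)
Lemma star_heavy u t : heavy u -> e u t ->
  n * degree e u + crossing u t <= \sum_(x | e u x) crossing u x + n.
Proof.
move=> hu eut; rewrite /degree -sum1_card (bigD1 t) ?inE //=.
rewrite [in leqRHS](bigD1 t) //= mulnDr muln1 big_distrr /=.
suff : \sum_(i in [set y | e u y] | i != t) n * 1
       <= \sum_(i | e u i && (i != t)) crossing u i by lia.
rewrite (eq_bigl (fun i => e u i && (i != t))); last by move=> i; rewrite inE.
by apply: leq_sum => i /andP[eui _]; rewrite muln1 hu.
Qed.

Lemma star_heavy2 u t t' : heavy u -> e u t -> e u t' -> t != t' ->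
  n * degree e u + (crossing u t + crossing u t')
    <= \sum_(x | e u x) crossing u x + n.*2.
Proof.
move=> hu eut eut' tt'; rewrite /degree -sum1_card (bigD1 t) ?inE //=.
rewrite (bigD1 t') /= ?inE ?eut' 1?eq_sym //.
rewrite [in leqRHS](bigD1 t) //= [in leqRHS](bigD1 t') /= ?eut' 1?eq_sym //.
rewrite !mulnDr !muln1 big_distrr /=.
suff : \sum_(i | (i \in [set y | e u y]) && (i != t) && (i != t')) n * 1
       <= \sum_(i | e u i && (i != t) && (i != t')) crossing u i by lia.
rewrite (eq_bigl (fun i => e u i && (i != t) && (i != t'))); last first.
  by move=> i; rewrite inE.
by apply: leq_sum => i /andP[/andP[eui _] _]; rewrite muln1 hu.
Qed.

(** * Split vertices and the lower bound on the boundary *)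

Hypothesis side_nbr : forall p, exists q, e p.1 q.1 /\ (q \in X) = (p \in X).
Hypothesis side_third : forall p q, e p.1 q.1 -> (p \in X) = (q \in X) ->
  exists r, [/\ r != p, r != q, (r \in X) = (p \in X) & e p.1 r.1 || e q.1 r.1].

Definition split u := (0 < copies true u) && (0 < copies false u).

Lemma splitE s u : split u = (0 < copies s u) && (0 < copies (~~ s) u).
Proof. by case: s => //; rewrite andbC. Qed.

Lemma split_heavy u : split u -> heavy u.
Proof. by case/andP => u1 u0 t _; apply: (crossing_split (s := true)). Qed.

(** Here [crossing u v] is 2n - 2, and with c >= 1 copies of [t] on side [s], [crossing u t] is n +
    c(n - 2) >= 2n - 2. The two stars then give the bound with 4 - n in place of 1, and n >= 3
    suffices. *)
Lemma pair_third_bound s u v t k :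
    e u v -> e u t -> t != v -> split u -> split v ->
    copies s u = 1 -> copies s v = 1 -> ((t, k) \in X) = s ->
  n * (degree e u + degree e v) <= #|boundary eH X| + 1.
Proof.
move=> euv eut tv su sv u1 v1 tk; have ct : 0 < copies s t.
  by apply/copies_gt0P; exists k.
have := star_heavy2 (split_heavy su) euv eut.
rewrite eq_sym => /(_ tv) Hu.
have evu : e v u by rewrite e_sym.
have := star_heavy (split_heavy sv) evu; have := incident_crossing_le euv.
have := copiesD s u; have := copiesD s v; have := copiesD s t.
have := crossingE s u v; have := crossingE s u t; rewrite (crossingC v u).
rewrite u1 v1 mulnDr !mul1n; nia.
Qed.

(** The stars at [u] and [v] settle the case [crossing u v] >= 2n - 1. The only exception is a side
    with exactly one copy of each of [u] and [v], where a third vertex on that side supplies the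
    missing edge. *)
Lemma adjacent_split_bound u v :
    e u v -> split u -> split v ->
  n * (degree e u + degree e v) <= #|boundary eH X| + 1.
Proof.
move=> euv su sv; have evu : e v u by rewrite e_sym.
have [[s [us vs]]|none] : (exists s, copies s u = 1 /\ copies s v = 1) \/
    n.*2 <= (crossing u v).+1.
- have [[u1 v1]|nt] : (copies true u = 1 /\ copies true v = 1) \/
      ~ (copies true u = 1 /\ copies true v = 1) by lia.
    by left; exists true.
  have [[u1 v1]|nf] : (copies false u = 1 /\ copies false v = 1) \/
      ~ (copies false u = 1 /\ copies false v = 1) by lia.
    by left; exists false.
  right; case/andP: su sv => u1 u0 /andP[v1 v0].
  have := copiesD true u; have := copiesD true v; rewrite /crossing /=.
  by move: u1 u0 v1 v0 nt nf; move: (copies _ _) (copies _ _) (copies _ _) (copies _ _)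
    => a a' b b'; nia.
- have [i ui] : exists i, ((u, i) \in X) = s by apply/copies_gt0P; rewrite us.
  have [j vj] : exists i, ((v, i) \in X) = s by apply/copies_gt0P; rewrite vs.
  have [||[t k] [tu tv tX]] := side_third (p := (u, i)) (q := (v, j)).
  + by [].
  + by rewrite ui vj.
  (* Side [s] has no further copy of [u] or [v], so the third vertex lies over a different vertex of
     G. *)
  rewrite ui in tX; have tu' : t != u.
    by apply: contraNneq tu => tu; rewrite -tu in us ui *; rewrite (copies_eq1 us ui tX).
  have tv' : t != v.
    by apply: contraNneq tv => tv; rewrite -tv in vs vj *; rewrite (copies_eq1 vs vj tX).
  case/orP => /= et; first exact: pair_third_bound tX.
  by rewrite addnC; apply: pair_third_bound tX.
have := star_heavy (split_heavy su) euv; have := star_heavy (split_heavy sv) evu.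
by have := incident_crossing_le euv; rewrite (crossingC v u) mulnDr; lia.
Qed.

Lemma heavy_nbr_bound w v :
    (forall u, e w u -> ~~ split u) -> split w -> e w v -> heavy v ->
  n * (degree e w + degree e v) <= #|boundary eH X|.
Proof.
move=> nosplit sw ewv hv; have evw : e v w by rewrite e_sym.
have full s : exists2 t, e w t & crossing w t = n * copies (~~ s) w.
  have [i wi] : exists i, ((w, i) \in X) = s.
    by apply/copies_gt0P; move: sw; rewrite (splitE s) => /andP[].
  have [[t j] /= [ewt tj]] := side_nbr (w, i); exists t => //.
  rewrite crossingC; apply: crossing_full; move: (nosplit t ewt).
  rewrite (splitE s) negb_and -!eqn0Ngt => /orP[|/eqP//].
  by rewrite eqn0Ngt => /copies_gt0P[]; exists j; rewrite tj.
(* Since n >= 3, one side has at least two copies of [w]; a neighbour lying wholly on the other side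
   crosses each of them n times. *)
have [t ewt ct] : exists2 t, e w t & n.*2 <= crossing w t.
  have [t1 et1 c1] := full true; have [t2 et2 c2] := full false.
  have [le|lt] := leqP 2 (copies false w); [exists t1|exists t2] => //.
    by rewrite c1 /= -muln2 leq_mul2l le orbT.
  by have := copiesD true w; rewrite c2 /= -muln2 leq_mul2l; lia.
have := star_heavy (split_heavy sw) ewt; have := star_heavy hv evw.
by have := incident_crossing_le ewv; rewrite (crossingC v w) mulnDr; lia.
Qed.

(* When one of u, v is not split, whether (u, k) and (v, l) are separated
   depends on only one of k and l. *)
Lemma sum_slices :
    (forall u v, e u v -> ~~ (split u && split v)) ->
  n * (\sum_(k < n) #|boundary e [set w | (w, k) \in X]|) = #|boundary eH X|.
Proof.
move=> nosplit; rewrite card_boundary_product.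
rewrite (eq_bigr _ (fun k _ => card_boundary e [set w | (w, k) \in X])).
rewrite exchange_big big_distrr /=; apply: eq_bigr => u _.
rewrite exchange_big big_distrr /=; apply: eq_bigr => v euv.
have cD w : copies true w + copies false w = n := copiesD true w.
have cases : [\/ copies false u = 0, copies true u = 0, copies false v = 0
    | copies true v = 0].
  move: (nosplit _ _ euv); rewrite /split !negb_and -!eqn0Ngt.
  by case/orP => /orP[] /eqP; [constructor 2|constructor 1|constructor 4|constructor 3].
case: cases => c0.
- have -> : copies true u = n by move: (cD u); rewrite c0 addn0.
  rewrite -sum_copies; congr (_ * _).
  apply: eq_bigr => k _; rewrite !inE (copies_full (s := true) k c0) mul1n.
  by case: (_ \in X).
- rewrite c0 big1 ?muln0 // => k _.
  by rewrite !inE (copies_full (s := false) k c0).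
- rewrite c0 muln0 big1 ?muln0 // => k _.
  by rewrite !inE (copies_full (s := true) k c0) muln0.
- have -> : copies false v = n by move: (cD v); rewrite c0.
  rewrite [RHS]mulnC -sum_copies; congr (_ * _).
  apply: eq_bigr => k _; rewrite !inE (copies_full (s := false) k c0) muln1.
  by case: (_ \in X).
Qed.

(** In the application [m] is n times the degree sum of an edge of minimum edge-degree. *)
Lemma boundary_product_bound m x y :
    x \in X -> y \notin X ->
    (forall u v, e u v -> m <= n * (degree e u + degree e v)) ->
    (forall S, restricted_edge_cut e (boundary e S) ->
      m <= n ^ 2 * #|boundary e S| + 1) ->
  m <= #|boundary eH X| + 1.
Proof.
move=> xX yX mdeg mcut.
have [/existsP[u /existsP[v /and3P[euv su sv]]]|nosplit] :=
  boolP [exists u, exists v, [&& e u v, split u & split v]].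
  exact: leq_trans (mdeg _ _ euv) (adjacent_split_bound euv su sv).
have {}nosplit u v : e u v -> ~~ (split u && split v).
  move=> euv; apply: contra nosplit => suv.
  by apply/existsP; exists u; apply/existsP; exists v; rewrite euv.
have nosplit1 w u : split w -> e w u -> ~~ split u.
  by move=> sw /nosplit; rewrite sw.
(* Once the bound is assumed to fail, [heavy_nbr_bound] forbids a heavy vertex next to a split
   one. *)
have [//|lt] := leqP m (#|boundary eH X| + 1).
have split_nbr s w v : split w -> e w v -> copies (~~ s) v = 0 ->
    exists2 t, e v t & copies (~~ s) t = 0.
  move=> sw ewv v0.
  have [/existsP[t /andP[evt /eqP t0]]|none] :=
    boolP [exists t, e v t && (copies (~~ s) t == 0)]; first by exists t.
  (* [v] lies wholly on side [s] and each neighbour has a copy on the other side, which crosses all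
     n copies of [v]. *)
  have hv : heavy v.
    move=> t evt; rewrite (crossing_full _ v0) leq_pmulr // lt0n.
    by apply: contra none => t0; apply/existsP; exists t; rewrite evt.
  have := heavy_nbr_bound (fun u => @nosplit1 w u sw) sw ewv hv.
  by have := mdeg _ _ ewv; lia.
have full_nbr s w i : ((w, i) \in X) = s ->
    exists2 t, e w t & copies (~~ s) t = 0.
  move=> wi; have [[t j] /= [ewt tj]] := side_nbr (w, i).
  have [t0|t0] := posnP (copies (~~ s) t); first by exists t.
  (* The neighbour [t] is split, so [w] is not and lies wholly on side [s]; [split_nbr] then applies
     to [w]. *)
  have st : split t.
    by rewrite (splitE s) t0 andbT; apply/copies_gt0P; exists j; rewrite tj.
  have etw : e t w by rewrite e_sym.
  apply: (split_nbr s _ _ st etw); apply/eqP; rewrite eqn0Ngt.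
  apply: contra (nosplit1 _ _ st etw) => w0; rewrite (splitE s) w0 andbT.
  by apply/copies_gt0P; exists i.
have {}mcut k : m <= n ^ 2 * #|boundary e [set w | (w, k) \in X]| + 1.
  apply: mcut.
  have [x' _ x'0] := full_nbr true x.1 x.2 ltac:(by case: (x) xX).
  have [y' _ y'0] := full_nbr false y.1 y.2 ltac:(by case: (y) yX => ? ? /negbTE).
  apply: (boundary_restricted e_sym (x := x') (y := y')).
  - by rewrite inE (copies_full _ x'0).
  - by rewrite inE (copies_full (s := false) _ y'0).
  move=> z; have [t ezt t0] := full_nbr _ z k erefl; exists t; split=> //.
    by apply: contraTneq ezt => ->; rewrite e_irr.
  by rewrite !inE (copies_full _ t0).
(* Summing over the slices gives [n * m <= n * (#|boundary eH X| + 1)], and n cancels. *)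
have : \sum_(k < n) m <= \sum_(k < n) (n ^ 2 * #|boundary e [set w | (w, k) \in X]| + 1).
  exact: leq_sum.
rewrite big_split /= -big_distrr /= !sum_nat_const card_ord muln1.
rewrite -mulnn -mulnA (sum_slices nosplit) -mulnSr leq_pmul2l; first by lia.
exact: leq_trans n_ge3.
Qed.

End Cut.
End Product.

(** * Components left by a restricted edge-cut *)

Lemma connect_exit (T : finType) (d : rel T) (S : {set T}) x y :
    connect d x y -> x \in S -> y \notin S ->
  exists a b, [/\ connect d x a, a \in S, b \notin S & d a b].
Proof.
case/connectP => p; elim: p x => [|z p IHp] x /=; first by move=> _ -> ->.
case/andP => dxz dp yE xS yS.
have [zS|zS] := boolP (z \in S); last by exists x, z; rewrite connect0.
have [a [b [za aS bS dab]]] := IHp _ dp yE zS yS.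
by exists a, b; split=> //; apply: connect_trans za; apply: connect1.
Qed.

Section Component.
Variables (T : finType) (e : rel T) (F : {set {set T}}).
Hypotheses (e_sym : symmetric e) (e_irr : irreflexive e).
Hypothesis F_restricted : restricted_edge_cut e F.

Notation d := (delete_edges e F).

Lemma delete_edges_connect_sym : connect_sym d.
Proof.
by apply: sym_connect_sym => x y; rewrite !delete_edgesE e_sym setUC.
Qed.

Definition component x := [set y | connect d x y].

Lemma component_mem x : component x \in components d.
Proof.
apply/imsetP; exists x => //.
by apply/setP => y; rewrite !inE.
Qed.

Lemma component_card x : 2 <= #|component x|.
Proof. by case/andP: F_restricted => _ /forall_inP; apply; apply: component_mem. Qed.

Lemma boundary_component_sub x : boundary e (component x) \subset F.
Proof.
apply/subsetP => _ /imsetP[[a b] /= ab ->].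
move: ab; rewrite !inE /= => /and3P[eab xa].
apply: contraNT => abF; apply: connect_trans xa _.
by apply: connect1; rewrite delete_edgesE eab.
Qed.

Lemma delete_edges_nbr x : exists y, d x y.
Proof.
have /card_gt0P[y] : 0 < #|component x :\ x|.
  by have := component_card x; rewrite (cardsD1 x) inE connect0.
rewrite !inE => /andP[yx xy].
have [||a [b [_ /set1P-> _ dxb]]] := connect_exit (S := [set x]) xy; last by exists b.
  by rewrite inE.
by rewrite inE.
Qed.

(** Having at least two vertices, the component is not contained in the pair; a path to a vertex
    outside leaves the pair along an edge at [x] or [y]. *)
Lemma component_third x y : component x != [set x; y] ->
  exists z, [/\ z != x, z != y, connect d x z & e x z || e y z].
Proof.
move=> Dxy; have : ~~ (component x \subset [set x; y]).
  apply: contra Dxy => sub; rewrite eqEcard sub (leq_trans _ (component_card x)) //.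
  by rewrite cards2 ltnS leq_b1.
case/subsetPn => z; rewrite inE => xz zxy.
have [a [b [xa aS bS /[dup] dab /andP[eab _]]]] := connect_exit xz (set21 x y) zxy.
exists b; move: bS; rewrite !inE negb_or => /andP[-> ->].
split=> //; first exact: connect_trans xa (connect1 dab).
by move: aS eab; rewrite !inE => /orP[]/eqP-> ->; rewrite ?orbT.
Qed.

Lemma component_pair_isolates x y :
  x != y -> component x = [set x; y] -> isolates_edge e F.
Proof.
move=> xy Dxy; exists x, y; split=> //; last by rewrite -Dxy component_mem.
have [z /[dup] dxz /andP[exz _]] := delete_edges_nbr x.
have : z \in component x by rewrite inE connect1.
rewrite Dxy !inE => /orP[]/eqP zE; last by rewrite -zE.
by rewrite zE e_irr in exz.
Qed.

End Component.

(** * The cut around an edge of the product *)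

Section PairCut.
Variables (T : finType) (e : rel T) (n : nat) (u v : T) (i : 'I_n).
Hypotheses (e_sym : symmetric e) (e_irr : irreflexive e) (euv : e u v).

Notation eH := (direct_product e (@total_graph n)).
Notation X := [set (u, i); (v, i)].

Let uv : u != v.
Proof. by apply: contraTneq euv => ->; rewrite e_irr. Qed.

Lemma pair_cut_restricted :
    1 < n -> (forall x, exists y, e x y) ->
  restricted_edge_cut eH (boundary eH X).
Proof.
move=> n_gt1 nbr; have [j ji] : exists j, j != i.
  have /card_gt0P[j] : 0 < #|[set~ i]| by rewrite cardsC1 card_ord; lia.
  by rewrite !inE; exists j.
apply: (boundary_restricted (product_total_sym e_sym) (x := (u, i)) (y := (u, j))).
- exact: set21.
- by rewrite !inE !xpair_eqE (negbTE ji) !andbF.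
move=> [w k]; have [wX|wX] := boolP ((w, k) \in X).
  case/set2P: wX => -[-> ->]; [exists (v, i)|exists (u, i)].
    by rewrite product_totalE set22 xpair_eqE eqxx andbT eq_sym uv.
  by rewrite product_totalE set21 xpair_eqE eqxx andbT uv e_sym.
(* Layer [j] misses the pair, so a neighbour there is on the outer side too. *)
have [y ewy] := nbr w; exists (y, j); split; first by rewrite product_totalE.
  by rewrite xpair_eqE negb_and; apply/orP; left; apply: contraTneq ewy => ->; rewrite e_irr.
by rewrite !inE !xpair_eqE (negbTE ji) !andbF.
Qed.

(** The two ends have degrees n d(u) and n d(v) in the product; their common edge is counted at both
    and is not cut. *)
Lemma card_pair_cut : #|boundary eH X| + 2 <= n * (degree e u + degree e v).
Proof.
rewrite card_boundary_product.
have cT w : copies X true w = (w == u) || (w == v).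
  rewrite /copies; have [wuv|/negbTE wuv] := boolP (_ || _).
    rewrite -[RHS](cards1 i); apply: eq_card => k.
    by rewrite !inE !xpair_eqE -andb_orl wuv eqb_id.
  by apply: eq_card0 => k; rewrite !inE !xpair_eqE -andb_orl wuv.
have cD w : copies X true w + copies X false w = n := copiesD X true w.
have star a b : e a b -> (b == u) || (b == v) ->
    \sum_(t | e a t) copies X false t < n * degree e a.
  move=> eab bX; rewrite /degree -sum1_card big_distrr /= (bigD1 b) //=.
  rewrite [in ltnRHS](bigD1 b) ?inE //= -addSn; apply: leq_add.
    by have := cD b; rewrite cT bX; lia.
  rewrite [leqRHS](eq_bigl (fun t => e a t && (t != b))); last by move=> t; rewrite inE.
  by apply: leq_sum => t _; have := cD t; lia.
rewrite (bigD1 u) //= [X in _ + X + _](bigD1 v) 1?eq_sym //=.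
rewrite [X in _ + (_ + X)]big1 => [|w]; last first.
  case/andP => /negbTE wu /negbTE wv.
  by apply: big1 => t _; rewrite cT wu wv.
rewrite -!big_distrr /= !cT !eqxx orbT !mul1n.
have := star u v euv; have := star v u; rewrite e_sym euv !eqxx orbT.
by move=> /(_ erefl erefl) ? /(_ erefl) ?; rewrite mulnDr; lia.
Qed.

End PairCut.

(** * Minimum edge-degree and restricted edge-connectivity as attained or bounding values *)

Section Bounds.
Variables (T : finType) (e : rel T).

(** An edge makes the family nonempty, so the minimum is not the default [+oo]. *)
Lemma min_edge_degree_attained u v : e u v ->
  exists p, [/\ e p.1 p.2,
    min_edge_degree e = ((degree e p.1 + degree e p.2)%:Z - 2)%R%:E &
    forall x y, e x y -> degree e p.1 + degree e p.2 <= degree e x + degree e y].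
Proof.
move=> euv; rewrite /min_edge_degree.
pose f (p : T * T) : \bar int := ((degree e p.1)%:Z + (degree e p.2)%:Z - 2)%R%:E.
have [p ep E] := @Order.TotalTheory.eq_bigmin _ _ _ (+oo)%E (u, v)
  (fun p : T * T => e p.1 p.2) f euv (fun p _ => leey (f p)).
exists p; split; [exact: ep | by rewrite PoszD; exact: E |].
move=> x y exy; have : (f p <= f (x, y))%O.
  by rewrite -E; apply: (@Order.TotalTheory.bigmin_le_cond _ _ _ _ (x, y)).
by rewrite /f lee_fin /=; lia.
Qed.

Lemma restricted_edge_connectivity_le F : restricted_edge_cut e F ->
  (restricted_edge_connectivity e <= #|F|%:Z%:E)%E.
Proof. exact: Order.TotalTheory.bigmin_le_cond. Qed.

End Bounds.

(** * Comparison of a minimum cut with the cut around an edge of minimum edge-degree *)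

Theorem theorem3p3 (T : finType) (e : rel T) (n : nat)
  (e_sym : symmetric e) (e_irr : irreflexive e)
  (T_nontrivial : 2 <= #|T|) (e_conn : connected_graph e)
  (n_ge3 : 3 <= n)
  (hlambda : (n%:Z%:E * min_edge_degree e + (2 * (n%:Z - 1))%R%:E
                < (n%:Z ^+ 2)%R%:E * restricted_edge_connectivity e)%E) :
  super_restricted_edge_connected (direct_product e (@total_graph n)).
Proof.
have nbr x : exists y, e x y.
  have /card_gt0P[y] : 0 < #|[set~ x]| by rewrite cardsC1; lia.
  rewrite inE => xy; have [a [b [_ /set1P-> _ exb]]] :=
    connect_exit (e_conn x y) (set11 x) xy.
  by exists b.
have /card_gt0P[x0 _] : 0 < #|T| by lia.
have [y0 exy0] := nbr x0.
have [[u v] /= [euv xiE degP]] := min_edge_degree_attained exy0.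
(* The left side of [hlambda] equals n (d(u) + d(v)) - 2; strictness between integers improves the 2
   to 1. *)
have lamP S : restricted_edge_cut e (boundary e S) ->
    n * (degree e u + degree e v) <= n ^ 2 * #|boundary e S| + 1.
  move/restricted_edge_connectivity_le => le.
  have n2 : (0 <= (n%:Z ^+ 2)%R%:E)%E by rewrite lee_fin; lia.
  have := Order.POrderTheory.lt_le_trans hlambda (lee_wpmul2l n2 le).
  by rewrite xiE -!EFinM -EFinD lte_fin; nia.
set eH := direct_product _ _ => F [Fcut Fmin].
have eH_sym : symmetric eH := product_total_sym e_sym.
have eH_irr : irreflexive eH by move=> p; rewrite /eH product_totalE e_irr.
have [/existsP[p /existsP[q /andP[pq /eqP pqE]]]|noiso] :=
    boolP [exists p, exists q, (p != q) && (component eH F p == [set p; q])].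
  exact: component_pair_isolates pqE.
exfalso; case/andP: (Fcut) => /andP[_ /existsP[p /existsP[q npq]]] _.
pose X := component eH F p.
have side a b : connect (delete_edges eH F) a b -> (b \in X) = (a \in X).
  move=> ab; rewrite !inE.
  exact/esym/(same_connect_r (delete_edges_connect_sym F eH_sym)).
have : n * (degree e u + degree e v) <= #|boundary eH X| + 1.
  apply: (@boundary_product_bound T e n e_sym e_irr X n_ge3 _ _ _ p q) => //.
  - move=> a; have [b /[dup] dab /andP[eab _]] := delete_edges_nbr Fcut a.
    exists b; split; last exact: side (connect1 dab).
    by move: eab; rewrite /eH product_totalE.
  - move=> a b eab _; have ab : a != b by apply: contraTneq eab => ->; rewrite e_irr.
    have [|c [ca cb ac eabc]] := component_third Fcut (x := a) (y := b).
      apply: contra noiso => abE.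
      by apply/existsP; exists a; apply/existsP; exists b; rewrite ab.
    exists c; split=> //; first exact: side.
    by move: eabc; rewrite /eH !product_totalE.
  - by rewrite inE connect0.
  - by rewrite inE.
  - by move=> x y exy; rewrite leq_mul2l degP ?orbT.
have i : 'I_n by case: (n) n_ge3 => // k _; exact: ord0.
(* The boundary of [X] is no larger than [F], hence than the pair cut, which has at most n (d(u) +
   d(v)) - 2 edges: one too few. *)
have := subset_leq_card (boundary_component_sub eH F p).
have := Fmin _ (pair_cut_restricted i e_sym e_irr euv (ltnW n_ge3) nbr).
have := card_pair_cut i e_sym e_irr euv.
by rewrite -/X -/eH; lia.
Qed.
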